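(* For all integers $m,n\ge 0$ and every complex $d$ with $\mathrm{Re}(d)>0$, \[ {}_3F_2\!\left(\begin{matrix}\tfrac12+m,\ \tfrac12-m,\ d+1\\ m+2n+\tfrac52,\ d\end{matrix};\tfrac12\right) =\frac{\pi}{2^{m+2n+\frac52}}\,(\tfrac32)_{m+2n+1} \left[\frac{\frac{2}{d}}{(m+n)!\,n!}+\frac{1-\frac{3/2+m+2n}{d}}{\pi\,(\tfrac12)_{m+n+1}(\tfrac12)_{n+1}}\right]. \]
   Context: For $\lambda\in\mathbb{C}$ and integer $n\ge0$, $(\lambda)_n$ is the Pochhammer symbol: $(\lambda)_0=1$, $(\lambda)_n=\lambda(\lambda+1)\cdots(\lambda+n-1)$ for $n\ge1$. The generalized hypergeometric series is ${}_pF_q\!\left(\begin{matrix}\alpha_1,\dots,\alpha_p\\ \beta_1,\dots,\beta_q\end{matrix};z\right)=\sum_{k=0}^\infty \frac{(\alpha_1)_k\cdots(\alpha_p)_k}{(\beta_1)_k\cdots(\beta_q)_k}\frac{z^k}{k!}$, convergent for $|z|<1$ when $p=q+1$. *)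

(* Defs.v *)
From Stdlib Require Import Reals List Factorial.
From Coquelicot Require Import Coquelicot.
Import ListNotations.

Open Scope C_scope.

Fixpoint pochhammer (a : C) (n : nat) : C :=
  match n with
  | O => 1
  | S k => pochhammer a k * (a + INR k)
  end.

Definition pochhammer_prod (l : list C) (k : nat) : C :=
  fold_right Cmult (RtoC 1) (map (fun a => pochhammer a k) l).

(* Division in C is total, so the terms below have their usual meaning
   only if no lower parameter is a nonpositive integer. *)
Definition hypergeometric_term (alphas betas : list C) (z : C) (k : nat) : C :=
  pochhammer_prod alphas k / pochhammer_prod betas k * (z ^ k / INR (fact k)).

(* The series pFq(alphas; betas; z), with p and q the lengths of the two lists,
   converges in C and its sum is s. *)
Definition is_hypergeometric (alphas betas : list C) (z s : C) : Prop :=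
  is_series (hypergeometric_term alphas betas z) s.

(* Main.v *)
Require Import Defs.
From Stdlib Require Import Reals List Factorial Lra Lia.
From Coquelicot Require Import Coquelicot.
Import ListNotations.

(** Since (d+1)_k / (d)_k = 1 + k/d and (c+k) / (c+1)_k = c / (c)_k, where
    c = m + 2n + 3/2, the 3F2 equals (1 - c/d) F(c+1) + (c/d) F(c) with
    F(c) = 2F1(1/2+m, 1/2-m; c; 1/2).  Both values are instances of Bailey's theorem for
    2F1(a, 1-a; c; 1/2).  At half-integers Bailey's theorem follows from the two-term relations
    (a,c) -> (a,c+2) and (a,c) -> (a+1,c+1), whose termwise differences telescope, and from
    the values 2F1(1/2,1/2;1/2;1/2) = sqrt 2 and 2F1(1/2,1/2;3/2;1/2) = sqrt 2 * PI / 4.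
    These two come from the series of (1 - x)^(-1/2) and of arcsin, at x = sin^2 (PI/4). *)

Open Scope R_scope.

(** * Real Pochhammer symbols and the terms of 2F1(a, 1-a; c; 1/2) *)

Fixpoint pochR (a : R) (n : nat) : R :=
  match n with
  | O => 1
  | S k => pochR a k * (a + INR k)
  end.

Lemma pochhammer_RtoC (a : R) (n : nat) : pochhammer (RtoC a) n = RtoC (pochR a n).
Proof.
induction n as [|n IH]; simpl; [reflexivity|].
now rewrite IH, RtoC_mult, RtoC_plus.
Qed.

Lemma pochR_pos (a : R) (n : nat) : 0 < a -> 0 < pochR a n.
Proof.
intros Ha; induction n as [|n IH]; simpl; [lra|].
pose proof (pos_INR n); apply Rmult_lt_0_compat; lra.
Qed.

Lemma pochR_shift (a : R) (n : nat) : a * pochR (a + 1) n = pochR a n * (a + INR n).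
Proof.
induction n as [|n IH]; [simpl; ring|].
change (pochR (a + 1) (S n)) with (pochR (a + 1) n * (a + 1 + INR n)).
rewrite <- Rmult_assoc, IH, S_INR; simpl; ring.
Qed.

Lemma pochR_S_l (a : R) (n : nat) : pochR a (S n) = a * pochR (a + 1) n.
Proof. now rewrite pochR_shift. Qed.

Definition bailey_term (a c : R) (k : nat) : R :=
  pochR a k * pochR (1 - a) k / (pochR c k * INR (fact k)) * (1 / 2) ^ k.

Lemma bailey_term_S (a c : R) (k : nat) : 0 < c ->
  bailey_term a c (S k) =
  bailey_term a c k * ((a + INR k) * (1 - a + INR k) / (2 * (c + INR k) * (INR k + 1))).
Proof.
intros Hc; unfold bailey_term.
rewrite fact_simpl, mult_INR, S_INR; simpl.
pose proof (pochR_pos c k Hc); pose proof (INR_fact_lt_0 k); pose proof (pos_INR k).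
field; repeat split; lra.
Qed.

Lemma bailey_term_lower (a c : R) (k : nat) : 0 < c ->
  (c + INR k) * bailey_term a (c + 1) k = c * bailey_term a c k.
Proof.
intros Hc; unfold bailey_term.
pose proof (pochR_pos c k Hc); pose proof (INR_fact_lt_0 k); pose proof (pos_INR k).
assert (E : pochR (c + 1) k = pochR c k * (c + INR k) / c).
{ rewrite <- pochR_shift; field; lra. }
rewrite E; field; repeat split; lra.
Qed.

(** Since (-a)_(k+1) = -a (1-a)_k, index k+1 on the left matches index k on the right. Comparing
    equal indices would bring in the denominator k - a, which vanishes when k = a. *)
Lemma bailey_term_raise (a c : R) (k : nat) : 0 < a -> 0 < c ->
  bailey_term (a + 1) (c + 1) (S k) =
  - bailey_term a c k *
  ((a + INR k) * (a + INR k + 1) * c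
   / (2 * (c + INR k) * (c + INR k + 1) * (INR k + 1))).
Proof.
intros Ha Hc; unfold bailey_term.
rewrite fact_simpl, mult_INR, S_INR.
pose proof (pochR_pos c k Hc); pose proof (INR_fact_lt_0 k); pose proof (pos_INR k).
assert (E1 : pochR (a + 1) (S k) = pochR a k * (a + INR k) * (a + INR k + 1) / a).
{ apply (Rmult_eq_reg_l a); [|lra].
  rewrite pochR_shift, S_INR; simpl; field; lra. }
assert (E2 : pochR (c + 1) (S k) = pochR c k * (c + INR k) * (c + INR k + 1) / c).
{ apply (Rmult_eq_reg_l c); [|lra].
  rewrite pochR_shift, S_INR; simpl; field; lra. }
assert (E3 : pochR (1 - (a + 1)) (S k) = - a * pochR (1 - a) k).
{ rewrite pochR_S_l; replace (1 - (a + 1)) with (- a) by ring.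
  now replace (- a + 1) with (1 - a) by ring. }
rewrite E1, E2, E3; simpl; field; repeat split; lra.
Qed.

(** * Telescoping and the two contiguous relations *)

Lemma is_series_bounded_mult_0 (u r : nat -> R) (s M : R) :
  is_series u s -> (forall n, Rabs (r n) <= M) -> is_lim_seq (fun n => u n * r n) 0.
Proof.
intros Hu Hr.
assert (Hu0 : is_lim_seq (fun n => Rabs (u n) * M) 0).
{ replace (Finite 0) with (Rbar_mult (Finite 0) M) by (simpl; f_equal; ring).
  apply is_lim_seq_scal_r, (proj1 (is_lim_seq_abs_0 u)).
  apply ex_series_lim_0; now exists s. }
apply is_lim_seq_abs_0.
apply is_lim_seq_le_le with (fun _ => 0) (fun n => Rabs (u n) * M);
  [|apply is_lim_seq_const|exact Hu0].
intros n; split; [apply Rabs_pos|].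
rewrite Rabs_mult; apply Rmult_le_compat_l; [apply Rabs_pos|apply Hr].
Qed.

(* The remainder [u n * r n] of the telescoping sum vanishes in the limit, so [p * sum u = q * sum v]. *)
Lemma is_series_contiguous (u v r : nat -> R) (p q s M : R) :
  q <> 0 -> is_series u s -> (forall n, Rabs (r n) <= M) ->
  (forall n, sum_n (fun k => p * u k - q * v k) n = u n * r n) ->
  is_series v (p / q * s).
Proof.
intros Hq Hu Hr Hsum.
assert (H0 : is_series (fun k => p * u k - q * v k) 0).
{ change (is_lim_seq (sum_n (fun k => p * u k - q * v k)) 0).
  apply is_lim_seq_ext with (fun n => u n * r n); [intros n; now rewrite Hsum|].
  now apply (is_series_bounded_mult_0 u r s M). }
pose proof (is_series_scal_l (/ q) _ _ (is_series_minus _ _ _ _ (is_series_scal_l p _ _ Hu) H0)) as H.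
replace (p / q * s) with (scal (/ q) (plus (scal p s) (opp 0)))
  by (unfold scal, plus, opp; simpl; unfold mult; simpl; field; assumption).
revert H; apply is_series_ext; intros n.
unfold scal, plus, opp; simpl; unfold mult; simpl; field; assumption.
Qed.

(* Gosper certificate: the difference of the two terms is [T (k+1) - T k] with
   [T k = - 2 * c * (c + 1) * k / (c + k) * bailey_term a c k]. *)
Lemma is_series_bailey_c2 (a c s : R) : 0 < a <= c ->
  is_series (bailey_term a c) s ->
  is_series (bailey_term a (c + 2)) (c * (c + 1) / ((c + a) * (c + 1 - a)) * s).
Proof.
intros [Ha Hac] Hs.
(* As T 0 = 0, the partial sum up to n is T (n+1). The ratio of consecutive terms turns this into
   [bailey_term a c n * r n]. *)
set (r := fun n => - c * (c + 1) * ((a + INR n) * (1 - a + INR n))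
                   / ((c + INR n) * (c + INR n + 1))).
apply (is_series_contiguous (bailey_term a c) _ r _ _ _ (c * (c + 1) * (1 + a))); auto.
- apply Rmult_integral_contrapositive; lra.
- intros n; unfold r; pose proof (pos_INR n).
  assert (Hd : 0 < (c + INR n) * (c + INR n + 1)) by (apply Rmult_lt_0_compat; lra).
  unfold Rdiv; rewrite !Rabs_mult, Rabs_inv, (Rabs_pos_eq ((c + INR n) * _)) by lra.
  rewrite Rabs_Ropp, (Rabs_pos_eq c), (Rabs_pos_eq (c + 1)), (Rabs_pos_eq (a + INR n)) by lra.
  apply (Rmult_le_reg_r ((c + INR n) * (c + INR n + 1))); [exact Hd|].
  rewrite Rmult_assoc, Rinv_l, Rmult_1_r by lra.
  rewrite !(Rmult_assoc (c * (c + 1))); apply Rmult_le_compat_l; [nra|].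
  (* This accounts for the factor 1 + a in the bound; the other factor is handled by a + n <= c +
     n. *)
  assert (Rabs (1 - a + INR n) <= (1 + a) * (c + INR n + 1)).
  { apply Rabs_le; split; nra. }
  pose proof (Rabs_pos (1 - a + INR n)).
  apply Rle_trans with ((c + INR n) * ((1 + a) * (c + INR n + 1))); [|lra].
  apply Rmult_le_compat; lra.
- assert (Hlow : forall k, bailey_term a (c + 2) k
     = c * (c + 1) / ((c + INR k) * (c + INR k + 1)) * bailey_term a c k).
  { intros k; pose proof (pos_INR k).
    assert (Hc : 0 < c) by lra; assert (Hc1 : 0 < c + 1) by lra.
    pose proof (bailey_term_lower a c k Hc) as E.
    pose proof (bailey_term_lower a (c + 1) k Hc1) as E1.
    replace (c + 2) with (c + 1 + 1) by ring.
    apply (Rmult_eq_reg_l ((c + INR k) * (c + 1 + INR k))); [|nra].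
    rewrite Rmult_assoc, E1.
    replace ((c + INR k) * ((c + 1) * bailey_term a (c + 1) k))
      with ((c + 1) * ((c + INR k) * bailey_term a (c + 1) k)) by ring.
    rewrite E; field; lra. }
  induction n as [|n IH].
  + rewrite sum_O, Hlow; unfold r, bailey_term; simpl; field; lra.
  + rewrite sum_Sn, IH, Hlow, bailey_term_S by lra; unfold r.
    rewrite S_INR; unfold plus; simpl; pose proof (pos_INR n).
    field; repeat split; lra.
Qed.

(* Gosper certificate: [T (k+1) - T k] with [T k = - 2 * c * k / (k - a) * bailey_term a c k]. *)
Lemma is_series_bailey_ac (a c s : R) : 0 < a <= c ->
  is_series (bailey_term a c) s ->
  is_series (bailey_term (a + 1) (c + 1)) (c / (c + a) * s).
Proof.
intros [Ha Hac] Hs.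
(* Again T (n+1) divided by the n-th term. The factor n + 1 - a of the term ratio cancels the
   denominator of T, so [r] has no pole at integer a. Since a <= c, it is bounded by c. *)
set (r := fun n => - c * (a + INR n) / (c + INR n)).
apply (is_series_contiguous (bailey_term a c) _ r _ _ _ c); auto.
- lra.
- intros n; unfold r; pose proof (pos_INR n).
  unfold Rdiv; rewrite !Rabs_mult, Rabs_inv, Rabs_Ropp, !Rabs_pos_eq by lra.
  apply (Rmult_le_reg_r (c + INR n)); [lra|].
  rewrite Rmult_assoc, Rinv_l, Rmult_1_r by lra.
  apply Rmult_le_compat_l; lra.
- induction n as [|n IH].
  + rewrite sum_O; unfold r, bailey_term; simpl; field; lra.
  + rewrite sum_Sn, IH, bailey_term_S, bailey_term_raise by lra; unfold r.
    rewrite S_INR; unfold plus; simpl; pose proof (pos_INR n).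
    field; repeat split; lra.
Qed.

(** * The power series of (1-x)^(-1/2) and of arcsin *)

Definition binom_coef (k : nat) : R := pochR (1 / 2) k / INR (fact k).

(** Coefficients of arcsin(y)/y as a power series in x = y^2. *)
Definition arcsin_coef (k : nat) : R := binom_coef k / (2 * INR k + 1).

Lemma binom_coef_S (k : nat) :
  (INR k + 1) * binom_coef (S k) = (INR k + 1 / 2) * binom_coef k.
Proof.
unfold binom_coef; rewrite fact_simpl, mult_INR, S_INR; simpl.
pose proof (INR_fact_lt_0 k); pose proof (pos_INR k); field; split; lra.
Qed.

(** The ratio of successive coefficients is (k + 1/2)/(k + 1) < 1. Such bounds put the radius of
    convergence at 1 or more, which covers the point 1/2. *)
Lemma binom_coef_bounds (k : nat) : 0 <= binom_coef k <= 1.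
Proof.
induction k as [|k IH]; [unfold binom_coef; simpl; lra|].
pose proof (binom_coef_S k); pose proof (pos_INR k); split.
- apply (Rmult_le_reg_l (INR k + 1)); nra.
- apply (Rmult_le_reg_l (INR k + 1)); nra.
Qed.

Lemma arcsin_coef_bounds (k : nat) : 0 <= arcsin_coef k <= 1.
Proof.
unfold arcsin_coef; pose proof (binom_coef_bounds k); pose proof (pos_INR k).
split; [apply Rdiv_le_0_compat; lra|].
apply Rle_div_l; lra.
Qed.

Lemma CV_radius_unit_bounded (a : nat -> R) (x : R) :
  (forall k, 0 <= a k <= 1) -> 0 <= x < 1 -> Rbar_lt (Rabs x) (CV_radius a).
Proof.
intros Ha Hx; rewrite Rabs_pos_eq by lra.
apply Rbar_lt_le_trans with 1; [simpl; lra|].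
apply (proj1 (CV_radius_bounded a)); exists 1; intros n.
rewrite pow1, Rmult_1_r, Rabs_pos_eq; apply Ha.
Qed.

Lemma is_pseries_unit_bounded (a : nat -> R) (x : R) :
  (forall k, 0 <= a k <= 1) -> 0 <= x < 1 -> is_pseries a x (PSeries a x).
Proof.
intros Ha Hx.
apply PSeries_correct, CV_radius_inside, CV_radius_unit_bounded; assumption.
Qed.

Lemma is_pseries_derive_unit_bounded (a : nat -> R) (x : R) :
  (forall k, 0 <= a k <= 1) -> 0 <= x < 1 ->
  is_pseries (PS_derive a) x (PSeries (PS_derive a) x).
Proof.
intros Ha Hx.
apply PSeries_correct, CV_radius_inside.
rewrite CV_radius_derive; apply CV_radius_unit_bounded; assumption.
Qed.

(** The differential equation of (1-x)^(-1/2), obtained by comparing coefficients in f' = x f' + f/2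
    through [binom_coef_S]. *)
Lemma binom_ode (x : R) : 0 <= x < 1 ->
  2 * (1 - x) * PSeries (PS_derive binom_coef) x = PSeries binom_coef x.
Proof.
intros Hx.
pose proof (is_pseries_unit_bounded _ _ binom_coef_bounds Hx) as Hf.
pose proof (is_pseries_derive_unit_bounded _ _ binom_coef_bounds Hx) as Hd.
pose proof (is_pseries_incr_1 _ _ _ Hd) as Hi.
pose proof (is_pseries_plus _ _ _ _ _ Hi (is_pseries_scal (1 / 2) _ _ _ (Rmult_comm _ _) Hf)) as Hs.
assert (E : PSeries (PS_derive binom_coef) x
            = x * PSeries (PS_derive binom_coef) x + 1 / 2 * PSeries binom_coef x).
{ refine (eq_trans _ (is_pseries_unique _ _ _ Hs)).
  apply PSeries_ext; intros n.
  unfold PS_derive at 1; rewrite S_INR, binom_coef_S.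
  unfold PS_derive, PS_plus, PS_scal, PS_incr_1, plus, scal, mult.
  destruct n; cbn -[INR]; [unfold zero; simpl; ring|ring]. }
lra.
Qed.

(** The operator g + 2 x g' multiplies the k-th coefficient by 2k + 1, the denominator in
    [arcsin_coef]. *)
Lemma arcsin_ode (x : R) : 0 <= x < 1 ->
  PSeries arcsin_coef x + 2 * x * PSeries (PS_derive arcsin_coef) x = PSeries binom_coef x.
Proof.
intros Hx.
pose proof (is_pseries_unit_bounded _ _ arcsin_coef_bounds Hx) as Hf.
pose proof (is_pseries_derive_unit_bounded _ _ arcsin_coef_bounds Hx) as Hd.
pose proof (is_pseries_incr_1 _ _ _ Hd) as Hi.
pose proof (is_pseries_plus _ _ _ _ _ Hf (is_pseries_scal 2 _ _ _ (Rmult_comm _ _) Hi)) as Hs.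
assert (E : PSeries binom_coef x
            = PSeries arcsin_coef x + 2 * (x * PSeries (PS_derive arcsin_coef) x)).
{ refine (eq_trans _ (is_pseries_unique _ _ _ Hs)).
  apply PSeries_ext; intros n.
  unfold PS_derive, PS_plus, PS_scal, PS_incr_1, plus, scal, mult, arcsin_coef.
  pose proof (pos_INR n).
  destruct n; cbn -[INR]; [unfold zero; simpl; field|]. rewrite !S_INR in *; field; lra. }
lra.
Qed.

Lemma sin2_range (t : R) : 0 <= t <= PI / 4 -> 0 <= sin t * sin t < 1.
Proof.
intros Ht; pose proof PI_RGT_0.
assert (0 < cos t) by (apply cos_gt_0; lra).
pose proof (sin2_cos2 t); unfold Rsqr in *; nra.
Qed.

Lemma is_derive_PSeries_sin2 (a : nat -> R) (t : R) :
  (forall k, 0 <= a k <= 1) -> 0 <= t <= PI / 4 ->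
  is_derive (fun u => PSeries a (sin u * sin u)) t
    (2 * sin t * cos t * PSeries (PS_derive a) (sin t * sin t)).
Proof.
intros Ha Ht.
apply (is_derive_comp (PSeries a) (fun u => sin u * sin u)).
- apply is_derive_PSeries, CV_radius_unit_bounded; auto using sin2_range.
- auto_derive; [trivial|ring].
Qed.

(** By [binom_ode] at sin^2 t and cos^2 t = 1 - sin^2 t, the left side has derivative zero; at t = 0
    it equals 1. *)
Lemma cos_binom_series (t : R) : 0 <= t <= PI / 4 ->
  cos t * PSeries binom_coef (sin t * sin t) = 1.
Proof.
(* [eq_is_derive] compares the ends of a nondegenerate interval, so t = 0 is treated separately. *)
intros [[Ht0|<-] Ht].
2: { rewrite cos_0, sin_0, Rmult_0_r, PSeries_0; unfold binom_coef; simpl; lra. }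
rewrite <- (eq_is_derive (fun u => cos u * PSeries binom_coef (sin u * sin u)) 0 t); [| |exact Ht0].
- rewrite cos_0, sin_0, Rmult_0_r, PSeries_0; unfold binom_coef; simpl; lra.
- intros u Hu; assert (Hu' : 0 <= u <= PI / 4) by lra.
  pose proof (is_derive_mult cos _ u _ _ (is_derive_cos u)
    (is_derive_PSeries_sin2 _ _ binom_coef_bounds Hu') Rmult_comm) as H.
  replace (@zero R_NormedModule) with
    (plus (mult (- sin u) (PSeries binom_coef (sin u * sin u)))
       (mult (cos u) (2 * sin u * cos u * PSeries (PS_derive binom_coef) (sin u * sin u)))); [exact H|].
  unfold plus, mult, zero; simpl.
  rewrite <- (binom_ode _ (sin2_range _ Hu')).
  pose proof (sin2_cos2 u) as E; unfold Rsqr in E.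
  replace (cos u * (2 * sin u * cos u * PSeries (PS_derive binom_coef) (sin u * sin u)))
    with (2 * sin u * (cos u * cos u) * PSeries (PS_derive binom_coef) (sin u * sin u)) by ring.
  replace (cos u * cos u) with (1 - sin u * sin u) by lra; ring.
Qed.

(** By [arcsin_ode], the derivative of the left side is cos t times the binomial series at sin^2 t,
    which is 1 by [cos_binom_series]. Hence subtracting t leaves a constant, zero at t = 0. *)
Lemma sin_arcsin_series (t : R) : 0 <= t <= PI / 4 ->
  sin t * PSeries arcsin_coef (sin t * sin t) = t.
Proof.
intros [[Ht0|<-] Ht].
2: { rewrite sin_0; ring. }
enough (E : sin t * PSeries arcsin_coef (sin t * sin t) - t = 0) by lra.
rewrite <- (eq_is_derive (fun u => sin u * PSeries arcsin_coef (sin u * sin u) - u) 0 t); [| |exact Ht0].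
- rewrite sin_0; ring.
- intros u Hu; assert (Hu' : 0 <= u <= PI / 4) by lra.
  pose proof (is_derive_minus _ _ u _ _ (is_derive_mult sin _ u _ _ (is_derive_sin u)
    (is_derive_PSeries_sin2 _ _ arcsin_coef_bounds Hu') Rmult_comm) (is_derive_id u)) as H.
  match type of H with is_derive _ _ ?l => replace (@zero R_NormedModule) with l; [exact H|] end.
  unfold minus, plus, opp, mult, zero, one; simpl.
  pose proof (arcsin_ode _ (sin2_range _ Hu')) as E1.
  pose proof (cos_binom_series _ Hu') as E2.
  rewrite <- E1 in E2; lra.
Qed.

(** * Bailey's theorem when a is a half-integer and c - a a natural number *)

Lemma bailey_base_half : is_series (bailey_term (1 / 2) (1 / 2)) (sqrt 2).
Proof.
assert (Hs := Rlt_sqrt2_0).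
assert (Hs2 : sqrt 2 * sqrt 2 = 2) by (apply sqrt_sqrt; lra).
assert (Ht : 0 <= PI / 4 <= PI / 4) by (pose proof PI_RGT_0; lra).
pose proof (cos_binom_series _ Ht) as E.
rewrite sin_PI4, cos_PI4 in E.
replace (1 / sqrt 2 * (1 / sqrt 2)) with (1 / (sqrt 2 * sqrt 2)) in E by (field; lra).
rewrite Hs2 in E.
replace (sqrt 2) with (PSeries binom_coef (1 / 2)).
2: { transitivity (sqrt 2 * (1 / sqrt 2 * PSeries binom_coef (1 / 2)));
     [field; lra|rewrite E; ring]. }
assert (Hx : 0 <= 1 / 2 < 1) by lra.
generalize (proj1 (is_pseries_R _ _ _) (is_pseries_unit_bounded _ _ binom_coef_bounds Hx)).
apply is_series_ext; intros n; unfold binom_coef, bailey_term.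
match goal with |- ?x = ?y => change (@eq R x y) end.
replace (1 - 1 / 2) with (1 / 2) by lra.
assert (0 < pochR (1 / 2) n) by (apply pochR_pos; lra).
pose proof (INR_fact_lt_0 n); field; lra.
Qed.

(** As (3/2)_k = (2k+1) (1/2)_k, the terms are those of the arcsin series at 1/2 = sin^2(PI/4),
    whose sum is (PI/4)/sin(PI/4). *)
Lemma bailey_base_three_halves :
  is_series (bailey_term (1 / 2) (3 / 2)) (sqrt 2 * PI / 4).
Proof.
assert (Hs := Rlt_sqrt2_0).
assert (Hs2 : sqrt 2 * sqrt 2 = 2) by (apply sqrt_sqrt; lra).
assert (Ht : 0 <= PI / 4 <= PI / 4) by (pose proof PI_RGT_0; lra).
pose proof (sin_arcsin_series _ Ht) as E.
rewrite sin_PI4 in E.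
replace (1 / sqrt 2 * (1 / sqrt 2)) with (1 / (sqrt 2 * sqrt 2)) in E by (field; lra).
rewrite Hs2 in E.
replace (sqrt 2 * PI / 4) with (PSeries arcsin_coef (1 / 2)).
2: { transitivity (sqrt 2 * (1 / sqrt 2 * PSeries arcsin_coef (1 / 2)));
     [field; lra|rewrite E; field]. }
assert (Hx : 0 <= 1 / 2 < 1) by lra.
generalize (proj1 (is_pseries_R _ _ _) (is_pseries_unit_bounded _ _ arcsin_coef_bounds Hx)).
apply is_series_ext; intros n; unfold arcsin_coef, binom_coef, bailey_term.
match goal with |- ?x = ?y => change (@eq R x y) end.
replace (1 - 1 / 2) with (1 / 2) by lra.
replace (3 / 2) with (1 / 2 + 1) by lra.
assert (0 < pochR (1 / 2) n) by (apply pochR_pos; lra).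
pose proof (INR_fact_lt_0 n); pose proof (pos_INR n).
assert (E1 : pochR (1 / 2 + 1) n = pochR (1 / 2) n * (2 * INR n + 1)).
{ apply (Rmult_eq_reg_l (1 / 2)); [|lra]; rewrite pochR_shift; field. }
rewrite E1; field; lra.
Qed.

(** One relation keeps c - a fixed and the other raises it by 2. From a = c = 1/2, first j grows at
    m = 0, then m grows at fixed j. Bailey's denominator Gamma((c+a)/2) Gamma((c+1-a)/2) has
    half-integer arguments when c - a = 2j, hence the symbols at 1/2. *)
Lemma bailey_even (m j : nat) :
  is_series (bailey_term (1 / 2 + INR m) (1 / 2 + INR m + 2 * INR j))
    (sqrt 2 * pochR (1 / 2) (m + 2 * j)
     / (2 ^ (m + 2 * j) * pochR (1 / 2) j * pochR (1 / 2) (m + j))).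
Proof.
assert (Hp : forall n, 0 < pochR (1 / 2) n) by (intros; apply pochR_pos; lra).
induction m as [|m IH].
- induction j as [|j IH].
  + replace (1 / 2 + INR 0) with (1 / 2) by (simpl; lra).
    replace (1 / 2 + 2 * INR 0) with (1 / 2) by (simpl; lra).
    replace (sqrt 2 * _ / _) with (sqrt 2) by (simpl; field).
    exact bailey_base_half.
  + pose proof (pos_INR j); pose proof (Hp j).
    assert (Hc : 0 < 1 / 2 + INR 0 <= 1 / 2 + INR 0 + 2 * INR j) by (simpl; lra).
    pose proof (is_series_bailey_c2 _ _ _ Hc IH) as Hstep.
    replace (1 / 2 + INR 0 + 2 * INR (S j)) with (1 / 2 + INR 0 + 2 * INR j + 2)
      by (rewrite (S_INR j); ring).
    match type of Hstep with is_series _ ?l =>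
      match goal with |- is_series _ ?l' => replace l' with l; [exact Hstep|] end end.
    replace (0 + 2 * S j)%nat with (S (S (2 * j))) by lia.
    replace (0 + 2 * j)%nat with (2 * j)%nat by lia.
    replace (0 + S j)%nat with (S j) by lia.
    replace (0 + j)%nat with j by lia.
    cbn [pochR pow]; rewrite S_INR, mult_INR.
    change (INR 2) with 2; change (INR 0) with 0.
    assert (0 < 2 ^ (2 * j)) by (apply pow_lt; lra).
    field; repeat split; lra.
- pose proof (pos_INR j); pose proof (pos_INR m); pose proof (Hp j); pose proof (Hp (m + j)%nat).
  assert (Hc : 0 < 1 / 2 + INR m <= 1 / 2 + INR m + 2 * INR j) by lra.
  pose proof (is_series_bailey_ac _ _ _ Hc IH) as Hstep.
  rewrite S_INR.
  replace (1 / 2 + (INR m + 1) + 2 * INR j) with (1 / 2 + INR m + 2 * INR j + 1) by ring.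
  replace (1 / 2 + (INR m + 1)) with (1 / 2 + INR m + 1) by ring.
  match type of Hstep with is_series _ ?l =>
    match goal with |- is_series _ ?l' => replace l' with l; [exact Hstep|] end end.
  replace (S m + 2 * j)%nat with (S (m + 2 * j)) by lia.
  replace (S m + j)%nat with (S (m + j)) by lia.
  cbn [pochR pow]; rewrite !plus_INR, mult_INR; change (INR 2) with 2.
  assert (0 < 2 ^ (m + 2 * j)) by (apply pow_lt; lra).
  field; repeat split; lra.
Qed.

(** The same double induction, started at c - a = 1. The arguments of Bailey's Gamma factors are now
    the integers m + j + 1 and j + 1, hence the factorials. *)
Lemma bailey_odd (m j : nat) :
  is_series (bailey_term (1 / 2 + INR m) (3 / 2 + INR m + 2 * INR j))
    (sqrt 2 * PI / 4 * pochR (3 / 2) (m + 2 * j)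
     / (2 ^ (m + 2 * j) * INR (fact j) * INR (fact (m + j)))).
Proof.
pose proof INR_fact_lt_0 as Hp.
induction m as [|m IH].
- induction j as [|j IH].
  + replace (1 / 2 + INR 0) with (1 / 2) by (simpl; lra).
    replace (3 / 2 + INR 0 + 2 * INR 0) with (3 / 2) by (simpl; lra).
    replace (sqrt 2 * PI / 4 * _ / _) with (sqrt 2 * PI / 4) by (simpl; field).
    exact bailey_base_three_halves.
  + pose proof (pos_INR j); pose proof (Hp j).
    assert (Hc : 0 < 1 / 2 + INR 0 <= 3 / 2 + INR 0 + 2 * INR j) by (simpl; lra).
    pose proof (is_series_bailey_c2 _ _ _ Hc IH) as Hstep.
    replace (3 / 2 + INR 0 + 2 * INR (S j)) with (3 / 2 + INR 0 + 2 * INR j + 2)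
      by (rewrite (S_INR j); ring).
    match type of Hstep with is_series _ ?l =>
      match goal with |- is_series _ ?l' => replace l' with l; [exact Hstep|] end end.
    replace (0 + 2 * S j)%nat with (S (S (2 * j))) by lia.
    replace (0 + 2 * j)%nat with (2 * j)%nat by lia.
    replace (0 + S j)%nat with (S j) by lia.
    replace (0 + j)%nat with j by lia.
    rewrite fact_simpl, (mult_INR (S j)), (S_INR j).
    cbn [pochR pow]; rewrite S_INR, mult_INR.
    change (INR 2) with 2; change (INR 0) with 0.
    assert (0 < 2 ^ (2 * j)) by (apply pow_lt; lra).
    field; repeat split; lra.
- pose proof (pos_INR j); pose proof (pos_INR m); pose proof (Hp j); pose proof (Hp (m + j)%nat).
  assert (Hc : 0 < 1 / 2 + INR m <= 3 / 2 + INR m + 2 * INR j) by lra.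
  pose proof (is_series_bailey_ac _ _ _ Hc IH) as Hstep.
  rewrite S_INR.
  replace (3 / 2 + (INR m + 1) + 2 * INR j) with (3 / 2 + INR m + 2 * INR j + 1) by ring.
  replace (1 / 2 + (INR m + 1)) with (1 / 2 + INR m + 1) by ring.
  match type of Hstep with is_series _ ?l =>
    match goal with |- is_series _ ?l' => replace l' with l; [exact Hstep|] end end.
  replace (S m + 2 * j)%nat with (S (m + 2 * j)) by lia.
  replace (S m + j)%nat with (S (m + j)) by lia.
  rewrite fact_simpl, (mult_INR (S (m + j))), (S_INR (m + j)).
  cbn [pochR pow]; rewrite !plus_INR, mult_INR; change (INR 2) with 2.
  assert (0 < 2 ^ (m + 2 * j)) by (apply pow_lt; lra).
  field; repeat split; lra.
Qed.

(** * Passage to C and splitting of the 3F2 *)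

Lemma sum_n_RtoC (u : nat -> R) (n : nat) :
  sum_n (fun k => RtoC (u k)) n = RtoC (sum_n u n).
Proof.
induction n as [|n IH]; [now rewrite !sum_O|].
rewrite !sum_Sn, IH; unfold plus; simpl; now rewrite RtoC_plus.
Qed.

(** Balls in C are products of real balls, and all imaginary parts here are zero. *)
Lemma is_series_RtoC (u : nat -> R) (s : R) :
  is_series u s -> is_series (fun k => RtoC (u k)) (RtoC s).
Proof.
intros H; apply filterlim_locally; intros eps.
generalize (proj1 (filterlim_locally _ _) H eps); apply filter_imp; intros n Hn.
rewrite sum_n_RtoC; split; [exact Hn|apply ball_center].
Qed.

Lemma Rpower_2_half (k : nat) : Rpower 2 (INR k + 1 / 2) = 2 ^ k * sqrt 2.
Proof.
rewrite Rpower_plus, Rpower_pow by lra.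
replace (1 / 2) with (/ 2) by lra; rewrite Rpower_sqrt by lra; reflexivity.
Qed.

Lemma pochhammer_neq_0 (d : C) (k : nat) : 0 < Re d -> pochhammer d k <> 0%C.
Proof.
intros Hd; induction k as [|k IH]; simpl; [apply C1_nz|apply Cmult_neq_0; auto].
intros E; apply (f_equal Re) in E; rewrite re_plus, !re_RtoC in E.
pose proof (pos_INR k); lra.
Qed.

Lemma Re_pos_neq_0 (d : C) : 0 < Re d -> d <> 0%C.
Proof. intros Hd E; rewrite E in Hd; simpl in Hd; lra. Qed.

Lemma pochhammer_succ_ratio (d : C) (k : nat) : 0 < Re d ->
  (pochhammer (d + 1)%C k / pochhammer d k = 1 + RtoC (INR k) / d)%C.
Proof.
intros Hd; pose proof (Re_pos_neq_0 d Hd) as Hd0.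
assert (E : (d * pochhammer (d + 1) k = pochhammer d k * (d + RtoC (INR k)))%C).
{ clear - Hd; induction k as [|k IH]; [simpl; ring|].
  change (pochhammer (d + 1) (S k)) with (pochhammer (d + 1) k * (d + 1 + RtoC (INR k)))%C.
  rewrite Cmult_assoc, IH, S_INR, RtoC_plus; simpl; ring. }
replace (pochhammer (d + 1)%C k) with (pochhammer d k * (d + RtoC (INR k)) / d)%C.
2: { rewrite <- E; field; exact Hd0. }
field; auto using pochhammer_neq_0.
Qed.

(** The factor 1 + k/d is written as (1 - c/d) + (c + k)/d. In the second part, [bailey_term_lower]
    absorbs c + k by lowering c + 1 to c. *)
Lemma is_hypergeometric_bailey_terms (a c : R) (d : C) (s1 s2 : R) :
  0 < Re d -> 0 < c ->
  is_series (bailey_term a (c + 1)) s1 -> is_series (bailey_term a c) s2 ->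
  is_hypergeometric [RtoC a; RtoC (1 - a); (d + 1)%C] [RtoC (c + 1); d] (1 / 2)%C
    ((1 - RtoC c / d) * RtoC s1 + RtoC (c * s2) / d)%C.
Proof.
intros Hd Hc H1 H2.
pose proof (Re_pos_neq_0 d Hd) as Hd0.
apply is_series_RtoC in H1.
apply (is_series_scal_l c), is_series_RtoC in H2.
pose proof (is_series_plus _ _ _ _
  (is_series_scal_l (1 - RtoC c / d)%C _ _ H1) (is_series_scal_l (/ d)%C _ _ H2)) as H.
unfold is_hypergeometric.
replace ((1 - RtoC c / d) * RtoC s1 + RtoC (c * s2) / d)%C
  with (plus (scal (1 - RtoC c / d)%C (RtoC s1)) (scal (/ d)%C (RtoC (scal c s2)))).
2: { unfold plus, scal; simpl; unfold mult; simpl; unfold Cdiv; ring. }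
revert H; apply is_series_ext; intros k.
unfold hypergeometric_term, pochhammer_prod; cbn [map fold_right].
rewrite !pochhammer_RtoC.
pose proof (bailey_term_lower a c k Hc) as E.
pose proof (pochhammer_succ_ratio d k Hd) as Hr.
transitivity (RtoC (bailey_term a (c + 1) k) * (pochhammer (d + 1) k / pochhammer d k))%C.
- rewrite Hr.
  change ((1 - RtoC c / d) * RtoC (bailey_term a (c + 1) k)
          + / d * RtoC (c * bailey_term a c k)
          = RtoC (bailey_term a (c + 1) k) * (1 + RtoC (INR k) / d))%C.
  rewrite <- E, RtoC_mult, RtoC_plus; field; exact Hd0.
- assert (Hpc : 0 < pochR (c + 1) k) by (apply pochR_pos; lra).
  pose proof (INR_fact_lt_0 k).
  pose proof (pochhammer_neq_0 d k Hd) as Hpd.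
  unfold bailey_term.
  match goal with |- ?x = ?y => change (@eq C x y) end.
  rewrite RtoC_mult, RtoC_div, !RtoC_mult, RtoC_pow, RtoC_div by nra.
  field; repeat split; try (intros E'; apply RtoC_inj in E'; lra); exact Hpd.
Qed.

(** * Matching the two values with the closed form *)

Definition bailey_prefactor (m n : nat) : R :=
  PI / Rpower 2 (INR m + 2 * INR n + 5 / 2) * pochR (3 / 2) (m + 2 * n + 1).

(** The power of 2 is 2^(m+2n+2) sqrt 2, and 1/sqrt 2 = sqrt 2 / 2 moves the root to the numerator,
    where [bailey_even] and [bailey_odd] have it. *)
Lemma bailey_prefactor_sqrt2 (m n : nat) :
  bailey_prefactor m n
  = PI * sqrt 2 / 2 ^ (m + 2 * n + 3) * pochR (3 / 2) (m + 2 * n + 1).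
Proof.
assert (Hs := Rlt_sqrt2_0).
assert (Hs2 : sqrt 2 * sqrt 2 = 2) by (apply sqrt_sqrt; lra).
assert (Hinv : 1 / sqrt 2 = sqrt 2 / 2).
{ apply (Rmult_eq_reg_l (sqrt 2)); [|lra].
  replace (sqrt 2 * (sqrt 2 / 2)) with (sqrt 2 * sqrt 2 / 2) by field.
  rewrite Hs2; field; lra. }
assert (Hpow : 0 < 2 ^ (m + 2 * n + 2)) by (apply pow_lt; lra).
unfold bailey_prefactor.
replace (INR m + 2 * INR n + 5 / 2) with (INR (m + 2 * n + 2) + 1 / 2).
2: { rewrite !plus_INR, mult_INR; change (INR 2) with 2; field. }
rewrite Rpower_2_half.
replace (PI / (2 ^ (m + 2 * n + 2) * sqrt 2))
  with (PI * (1 / sqrt 2) / 2 ^ (m + 2 * n + 2)) by (field; lra).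
rewrite Hinv; replace (m + 2 * n + 3)%nat with (S (m + 2 * n + 2)) by lia.
cbn [pow]; field; lra.
Qed.

Lemma bailey_upper_value (m n : nat) :
  is_series (bailey_term (1 / 2 + INR m) (3 / 2 + INR m + 2 * INR n + 1))
    (bailey_prefactor m n
     / (PI * pochR (1 / 2) (m + n + 1) * pochR (1 / 2) (n + 1))).
Proof.
(* The lower parameter is 5/2 + m + 2n = 1/2 + m + 2(n+1), so j = n + 1. *)
pose proof (bailey_even m (S n)) as H.
replace (1 / 2 + INR m + 2 * INR (S n)) with (3 / 2 + INR m + 2 * INR n + 1) in H
  by (rewrite S_INR; field).
match type of H with is_series _ ?l =>
  match goal with |- is_series _ ?l' => replace l' with l; [exact H|] end end.
rewrite bailey_prefactor_sqrt2.
replace (m + S n)%nat with (m + n + 1)%nat by lia.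
replace (S n) with (n + 1)%nat by lia.
replace (m + 2 * (n + 1))%nat with (S (m + 2 * n + 1)) by lia.
(* Splitting off the first factor of (1/2)_(m+2n+2) leaves the symbol (3/2)_(m+2n+1) of the
   prefactor. *)
rewrite pochR_S_l; replace (1 / 2 + 1) with (3 / 2) by field.
replace (m + 2 * n + 3)%nat with (S (S (m + 2 * n + 1))) by lia.
cbn [pow].
assert (Hp : forall j, 0 < pochR (1 / 2) j) by (intros; apply pochR_pos; lra).
pose proof (Hp (m + n + 1)%nat); pose proof (Hp (n + 1)%nat); pose proof PI_RGT_0.
assert (0 < 2 ^ (m + 2 * n + 1)) by (apply pow_lt; lra).
field; lra.
Qed.

(** The final division by c = 3/2 + m + 2n removes the last factor of (3/2)_(m+2n+1), since
    [bailey_odd] gives only (3/2)_(m+2n). *)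
Lemma bailey_lower_value (m n : nat) :
  is_series (bailey_term (1 / 2 + INR m) (3 / 2 + INR m + 2 * INR n))
    (bailey_prefactor m n * 2 / (INR (fact (m + n)) * INR (fact n))
     / (3 / 2 + INR m + 2 * INR n)).
Proof.
pose proof (bailey_odd m n) as H.
match type of H with is_series _ ?l =>
  match goal with |- is_series _ ?l' => replace l' with l; [exact H|] end end.
rewrite bailey_prefactor_sqrt2.
replace (m + 2 * n + 3)%nat with (S (S (S (m + 2 * n)))) by lia.
replace (m + 2 * n + 1)%nat with (S (m + 2 * n)) by lia.
cbn [pow pochR]; rewrite plus_INR, mult_INR; change (INR 2) with 2.
pose proof (INR_fact_lt_0 (m + n)); pose proof (INR_fact_lt_0 n).
pose proof (pos_INR m); pose proof (pos_INR n).
assert (0 < 2 ^ (m + 2 * n)) by (apply pow_lt; lra).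
field; lra.
Qed.

Open Scope C_scope.

Theorem theorem4 :
  forall (m n : nat) (d : C), (0 < Re d)%R ->
  is_hypergeometric
    [1 / 2 + INR m; 1 / 2 - INR m; d + 1]
    [INR m + 2 * INR n + 5 / 2; d]
    (1 / 2)
    (PI / Rpower 2 (INR m + 2 * INR n + 5 / 2)
     * pochhammer (3 / 2) (m + 2 * n + 1)
     * ((2 / d) / (INR (fact (m + n)) * INR (fact n))
        + (1 - (3 / 2 + INR m + 2 * INR n) / d)
          / (PI * pochhammer (1 / 2) (m + n + 1) * pochhammer (1 / 2) (n + 1)))).
Proof.
intros m n d Hd.
pose proof (pos_INR m); pose proof (pos_INR n); pose proof (Re_pos_neq_0 d Hd) as Hd0.
set (c := (3 / 2 + INR m + 2 * INR n)%R).
assert (Hc : (0 < c)%R) by (unfold c; lra).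
pose proof (is_hypergeometric_bailey_terms _ c d _ _ Hd Hc
  (bailey_upper_value m n) (bailey_lower_value m n)) as H1.
fold c in H1.
(* The fractions of the statement are quotients in C, whereas the lemmas embed real quotients. *)
assert (Hhalf : RtoC (1 / 2) = 1 / 2) by (rewrite RtoC_div; auto; lra).
assert (Hthree : RtoC (3 / 2) = 3 / 2) by (rewrite RtoC_div; auto; lra).
replace (1 / 2 + INR m) with (RtoC (1 / 2 + INR m)) by (rewrite RtoC_plus, Hhalf; ring).
replace (1 / 2 - INR m) with (RtoC (1 - (1 / 2 + INR m))).
2: { rewrite RtoC_minus, RtoC_plus, Hhalf; field. }
replace (INR m + 2 * INR n + 5 / 2) with (RtoC (c + 1)).
2: { unfold c; rewrite !RtoC_plus, Hthree, RtoC_mult; field. }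
match type of H1 with is_hypergeometric _ _ _ ?l =>
  match goal with |- is_hypergeometric _ _ _ ?l' => replace l' with l; [exact H1|] end end.
clear H1.
replace (3 / 2 + INR m + 2 * INR n) with (RtoC c).
2: { unfold c; rewrite !RtoC_plus, Hthree, RtoC_mult; ring. }
rewrite <- Hhalf, <- Hthree, !pochhammer_RtoC.
assert (Hp : forall j, (0 < pochR (1 / 2) j)%R) by (intros; apply pochR_pos; lra).
pose proof (Hp (m + n + 1)%nat); pose proof (Hp (n + 1)%nat); pose proof PI_RGT_0.
pose proof (INR_fact_lt_0 (m + n)); pose proof (INR_fact_lt_0 n).
rewrite <- (RtoC_div PI) by (apply Rgt_not_eq, exp_pos).
rewrite <- RtoC_mult; fold (bailey_prefactor m n).
(* The factor c from splitting the 3F2 cancels the division by c in [bailey_lower_value]. *)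
replace (c * (bailey_prefactor m n * 2 / (INR (fact (m + n)) * INR (fact n)) / c))%R
  with (bailey_prefactor m n * 2 / (INR (fact (m + n)) * INR (fact n)))%R by (field; lra).
rewrite !RtoC_div, !RtoC_mult
  by (repeat (lra || apply Rmult_integral_contrapositive_currified)).
field; repeat split; try (intros E; apply RtoC_inj in E; lra); exact Hd0.
Qed.
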